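(* The Griffiths space $\mathcal{G}$ and the Harmonic archipelago $\mathcal{HA}$ are not homotopy equivalent.
   Context: Here $\mathbb{N}=\{1,2,3,\dots\}$. Griffiths space. Let $$\mathbb{H}_+=\bigcup_{n\in\mathbb{N}}\{(x,y,0)\in\mathbb{R}^3 : x^2+(y-\tfrac1n)^2=(\tfrac1n)^2\},\qquad \mathbb{H}_-=\bigcup_{n\in\mathbb{N}}\{(x,y,0)\in\mathbb{R}^3 : x^2+(y+\tfrac1n)^2=(\tfrac1n)^2\}$$ be two copies of the Hawaiian earring. For a set $M\subset\mathbb{R}^2\times\{0\}$ and a point $v\in\mathbb{R}^3$ outside that plane, let $C(M,v)$ be the cone over $M$ with vertex $v$, i.e. the union of all straight line segments joining $v$ to points of $M$. The Griffiths space is the subspace $$\mathcal{G}=C(\mathbb{H}_+,(0,0,1))\cup C(\mathbb{H}_-,(0,0,-1))\subset\mathbb{R}^3 .$$ Harmonic archipelago. Let $K_n=\{(x,y)\in\mathbb{R}^2 : x^2+(y-\frac1n)^2=(\frac1n)^2\}$, so that $\mathbb{H}=\bigcup_{n\in\mathbb{N}}K_n\subset\mathbb{R}^2$ is the Hawaiian earring. The Harmonic archipelago $\mathcal{HA}$ is the noncompact subspace of $\mathbb{R}^3$ obtained from $\mathbb{H}$ by adjoining, for each $n$, a ''tall'' disk (of height $1$) between the consecutive loops $K_n$ and $K_{n+1}$. Concretely: let $D\subset\mathbb{R}^2$ be the closed disk bounded by $K_1$. For $n\in\mathbb{N}$ let $p_n=(0,\frac1n+\frac1{n+1})$ and $r_n=\frac{1}{2n(n+1)}$,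 so that the closed disk $B_n$ of center $p_n$ and radius $r_n$ lies in the open crescent-shaped region inside $K_n$ and outside $K_{n+1}$. Define $f:D\to\mathbb{R}$ by $f(p)=1-|p-p_n|/r_n$ if $p\in B_n$ for some $n$, and $f(p)=0$ otherwise. Then $\mathcal{HA}=\{(x,y,f(x,y)) : (x,y)\in D\}\subset\mathbb{R}^3$ with the subspace topology (note that $f$ is discontinuous at the origin). *)

(* Defs.v *)
From mathcomp Require Import all_boot all_order all_algebra ring lra.
From mathcomp Require Import all_classical all_reals all_analysis.

Set Implicit Arguments.
Unset Strict Implicit.
Unset Printing Implicit Defensive.

Import Order.TTheory GRing.Theory Num.Theory.
Import numFieldNormedType.Exports.

Local Open Scope classical_set_scope.
Local Open Scope ring_scope.

(* Only the restriction of H to X * [0, 1], with its subspace topology, is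
   constrained. *)
Definition homotopic (R : realType) (X Y : topologicalType) (f g : X -> Y) :=
  exists H : X * R -> Y,
    [/\ {within [set: X] `*` `[0, 1], continuous H},
        forall x, H (x, 0) = f x &
        forall x, H (x, 1) = g x].

Definition homotopy_equivalent (R : realType) (X Y : topologicalType) :=
  exists (f : X -> Y) (g : Y -> X),
    [/\ continuous f, continuous g,
        homotopic R (g \o f) idfun &
        homotopic R (f \o g) idfun].

(* R^2 and R^3 are represented by R * R and R * R * R = (R * R) * R. *)

Definition cone (R : realType) (M : set (R * R * R)) (v : R * R * R) :
    set (R * R * R) :=
  \bigcup_(m in M) [set (1 - t) *: v + t *: m | t in `[0, 1]].

Definition hawaiian_plus (R : realType) : set (R * R * R) :=
  \bigcup_(n in [set n | (0 < n)%N])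
    [set q | q.1.1 ^+ 2 + (q.1.2 - 1 / n%:R) ^+ 2 = (1 / n%:R) ^+ 2 /\ q.2 = 0].
Arguments hawaiian_plus : clear implicits.

Definition hawaiian_minus (R : realType) : set (R * R * R) :=
  \bigcup_(n in [set n | (0 < n)%N])
    [set q | q.1.1 ^+ 2 + (q.1.2 + 1 / n%:R) ^+ 2 = (1 / n%:R) ^+ 2 /\ q.2 = 0].
Arguments hawaiian_minus : clear implicits.

Definition griffiths (R : realType) : set (R * R * R) :=
  cone (hawaiian_plus R) (0, 0, 1) `|` cone (hawaiian_minus R) (0, 0, -1).
Arguments griffiths : clear implicits.

(* The library norm on R * R is the max norm, so the Euclidean one is needed. *)
Definition dist2 (R : realType) (p q : R * R) : R :=
  Num.sqrt ((p.1 - q.1) ^+ 2 + (p.2 - q.2) ^+ 2).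

Definition peak (R : realType) (n : nat) : R * R :=
  (0, 1 / n%:R + 1 / n.+1%:R).

Definition peak_radius (R : realType) (n : nat) : R :=
  1 / (2 * n%:R * n.+1%:R).

Definition peak_disk (R : realType) (n : nat) : set (R * R) :=
  [set p | dist2 p (peak R n) <= peak_radius R n].

(* At most one peak_disk n with n >= 1 contains p (peak_disk_inj); 0 is the
   default value, returned when there is none. *)
Definition height (R : realType) (p : R * R) : R :=
  let n := xget 0%N [set n | (0 < n)%N /\ peak_disk n p] in
  if n == 0%N then 0 else 1 - dist2 p (peak R n) / peak_radius R n.

Definition base_disk (R : realType) : set (R * R) :=
  [set p | p.1 ^+ 2 + (p.2 - 1) ^+ 2 <= 1].
Arguments base_disk : clear implicits.

Definition harmonic_archipelago (R : realType) : set (R * R * R) :=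
  [set (p, height p) | p in base_disk R].
Arguments harmonic_archipelago : clear implicits.

Lemma peak_disk_snd (R : realType) (n : nat) (p : R * R) :
  (0 < n)%N -> peak_disk n p -> 2 / n.+1%:R < p.2 < 2 / n%:R.
Proof.
move=> n0; rewrite /peak_disk /= => pn.
have x0 : 0 < n%:R :> R by rewrite ltr0n.
have S : n.+1%:R = n%:R + 1 :> R by rewrite -natr1.
have y0 : 0 < n%:R + 1 :> R by lra.
have r0 : 0 < peak_radius R n by rewrite /peak_radius S divr_gt0 // !mulr_gt0.
have {pn} /ler_normlP[h1 h2] : `|p.2 - (1 / n%:R + 1 / n.+1%:R)| <= peak_radius R n.
  apply: le_trans pn; rewrite /dist2 -sqrtr_sqr ler_sqrt ?addr_ge0 ?sqr_ge0 //.
  by rewrite lerDr sqr_ge0.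
have E : 1 / n%:R - 1 / n.+1%:R = 2 * peak_radius R n :> R.
  by rewrite /peak_radius S; field; apply/andP; split; lra.
have E1 : 2 / n%:R = 2 * (1 / n%:R) :> R by rewrite div1r.
have E2 : 2 / n.+1%:R = 2 * (1 / n.+1%:R) :> R by rewrite div1r.
rewrite E1 E2; move: h1 h2 E r0; set a := 1 / n%:R; set b := 1 / n.+1%:R.
by move: (peak_radius R n) => r *; apply/andP; split; lra.
Qed.

Lemma peak_disk_inj (R : realType) (m n : nat) (p : R * R) :
  (0 < m)%N -> (0 < n)%N -> peak_disk m p -> peak_disk n p -> m = n.
Proof.
wlog mn : m n / (m < n)%N => [H m0 n0 pm pn|m0 n0].
  by case: (ltngtP m n) => // mn; [apply: H | apply/esym; apply: H].
move=> /(peak_disk_snd m0)/andP[h1 _] /(peak_disk_snd n0)/andP[_ h2].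
have : 2 / n%:R <= 2 / m.+1%:R :> R.
  by rewrite ler_pM2l // lef_pV2 ?posrE ?ltr0n // ler_nat.
by move=> /(lt_le_trans h2)/(lt_trans h1); rewrite ltxx.
Qed.

Lemma height_peak_disk (R : realType) (n : nat) (p : R * R) :
  (0 < n)%N -> peak_disk n p ->
  height p = 1 - dist2 p (peak R n) / peak_radius R n.
Proof.
move=> n0 pn; rewrite /height (@xget_unique _ _ _ n) //=.
  by rewrite eqn0Ngt n0.
by move=> m [m0 pm]; exact: peak_disk_inj pm pn.
Qed.

Lemma height_out (R : realType) (p : R * R) :
  (forall n, (0 < n)%N -> ~ peak_disk n p) -> height p = 0.
Proof. by move=> h; rewrite /height xgetPN // => n [/h]. Qed.

(* Main.v *)
Require Import Defs.
From mathcomp Require Import all_boot all_order all_algebra ring lra.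
From mathcomp Require Import all_classical all_reals all_analysis.

Set Implicit Arguments.
Unset Strict Implicit.
Unset Printing Implicit Defensive.

Import Order.TTheory GRing.Theory Num.Theory.
Import numFieldNormedType.Exports.

Local Open Scope classical_set_scope.
Local Open Scope ring_scope.

(* Let [f : G -> HA] and [g : HA -> G] with [f \o g] homotopic to the identity,
   and let [K] be the outermost circle, which lies in [HA].  A compact subset
   of [HA] misses almost all the summits, since these converge to a point
   outside of [HA]; so there is a summit, say above [p], which is avoided by the
   homotopy restricted to [K] and by [f] on the cone over [g @` K].  Now project
   to the plane punctured at [p] and regard maps into it as nonvanishing complex
   functions.  Having a continuous square root is invariant under homotopies of
   functions on a compact space.  Each of the two cones of [G] is contractible
   and they meet in one point, so [f \o g - p] has a square root on [K], hence so
   does [z - p], and then [z - c], where [c] is the center of [K]: absurd. *)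

(** * Continuity of pointwise operations *)

Section Continuity.
Context {R : realType} {T : topologicalType}.
Implicit Types f g : T -> R.

Lemma continuous_add f g :
  continuous f -> continuous g -> continuous (fun x => f x + g x).
Proof. by move=> cf cg x; apply: continuousD; [exact: cf|exact: cg]. Qed.

Lemma continuous_opp f : continuous f -> continuous (fun x => - f x).
Proof. by move=> cf x; apply: continuousN; exact: cf. Qed.

Lemma continuous_sub f g :
  continuous f -> continuous g -> continuous (fun x => f x - g x).
Proof. by move=> cf cg x; apply: continuousB; [exact: cf|exact: cg]. Qed.

Lemma continuous_mul f g :
  continuous f -> continuous g -> continuous (fun x => f x * g x).
Proof. by move=> cf cg x; apply: continuousM; [exact: cf|exact: cg]. Qed.

Lemma continuous_div f g : (forall x, g x != 0) ->
  continuous f -> continuous g -> continuous (fun x => f x / g x).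
Proof.
move=> g0 cf cg x; apply: (@continuousM _ _ f (fun x => (g x)^-1)); first exact: cf.
by apply: continuousV; [exact: g0|exact: cg].
Qed.

Lemma continuous_sqrt f : continuous f -> continuous (fun x => Num.sqrt (f x)).
Proof.
move=> cf x; apply: (continuous_comp (f := f) (g := Num.sqrt)); first exact: cf.
exact: sqrt_continuous.
Qed.

Lemma continuous_maxr f g :
  continuous f -> continuous g -> continuous (fun x => Num.max (f x) (g x)).
Proof. by move=> cf cg x; apply: continuous_max; [exact: cf|exact: cg]. Qed.

Lemma continuous_minr f g :
  continuous f -> continuous g -> continuous (fun x => Num.min (f x) (g x)).
Proof. by move=> cf cg x; apply: continuous_min; [exact: cf|exact: cg]. Qed.

Lemma continuous_pair (U V : topologicalType) (f : T -> U) (g : T -> V) :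
  continuous f -> continuous g -> continuous (fun x => (f x, g x)).
Proof. by move=> cf cg x; apply: cvg_pair; [exact: cf|exact: cg]. Qed.

Lemma continuous_compose (U V : topologicalType) (f : T -> U) (g : U -> V) :
  continuous f -> continuous g -> continuous (fun x => g (f x)).
Proof. by move=> cf cg x; apply: continuous_comp; [exact: cf|exact: cg]. Qed.

Lemma continuous_fst (U V : topologicalType) (f : T -> U * V) :
  continuous f -> continuous (fun x => (f x).1).
Proof. by move=> cf; apply: (continuous_compose cf) => p; exact: cvg_fst. Qed.

Lemma continuous_snd (U V : topologicalType) (f : T -> U * V) :
  continuous f -> continuous (fun x => (f x).2).
Proof. by move=> cf; apply: (continuous_compose cf) => p; exact: cvg_snd. Qed.

End Continuity.

(** * Continuous square roots of complex-valued functions *)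

(** The pair [(u, v)] encodes [u + i v], and [(a, b)] its root [a + i b]. *)
Definition has_sqrt (R : realType) (T : topologicalType) (u v : T -> R) :=
  exists a b : T -> R, [/\ continuous a, continuous b,
    forall x, u x = a x ^+ 2 - b x ^+ 2 & forall x, v x = 2 * a x * b x].

Section Sqrt.
Context {R : realType} {T : topologicalType}.
Implicit Types u v : T -> R.

Lemma has_sqrt_ext u v u' v' : u =1 u' -> v =1 v' ->
  has_sqrt u v -> has_sqrt u' v'.
Proof. by move=> /funext -> /funext ->. Qed.

Lemma has_sqrt_mul u v u' v' : has_sqrt u v -> has_sqrt u' v' ->
  has_sqrt (fun x => u x * u' x - v x * v' x)
           (fun x => u x * v' x + v x * u' x).
Proof.
move=> [a [b [ca cb ua vb]]] [c [d [cc cd uc vd]]].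
exists (fun x => a x * c x - b x * d x), (fun x => a x * d x + b x * c x).
split.
- by apply: continuous_sub; apply: continuous_mul.
- by apply: continuous_add; apply: continuous_mul.
- by move=> x; rewrite ua vb uc vd; ring.
- by move=> x; rewrite ua vb uc vd; ring.
Qed.

(** The principal branch of the square root is continuous on the right half plane; its real part [a]
    is positive there, so the imaginary part is [v / (2 a)]. *)
Lemma has_sqrt_gt0 u v : continuous u -> continuous v ->
  (forall x, 0 < u x) -> has_sqrt u v.
Proof.
move=> cu cv u0.
pose a x := Num.sqrt ((Num.sqrt (u x ^+ 2 + v x ^+ 2) + u x) / 2).
have m0 x : 0 <= Num.sqrt (u x ^+ 2 + v x ^+ 2) by exact: sqrtr_ge0.
have mE x : Num.sqrt (u x ^+ 2 + v x ^+ 2) ^+ 2 = u x ^+ 2 + v x ^+ 2.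
  by rewrite sqr_sqrtr // addr_ge0 ?sqr_ge0.
have a0 x : 0 < a x.
  by rewrite sqrtr_gt0; have := m0 x; have := u0 x; lra.
have aE x : a x ^+ 2 = (Num.sqrt (u x ^+ 2 + v x ^+ 2) + u x) / 2.
  by rewrite sqr_sqrtr //; have := m0 x; have := u0 x; lra.
have ca : continuous a.
  apply: continuous_sqrt; apply: continuous_mul; last exact: cst_continuous.
  apply: continuous_add => //; apply: continuous_sqrt.
  by apply: continuous_add; apply: continuous_mul.
exists a, (fun x => v x / (2 * a x)); split => //.
- apply: continuous_div => // [x|]; first by rewrite mulf_neq0 ?gt_eqF.
  by apply: continuous_mul => //; exact: cst_continuous.
- move=> x; rewrite exprMn exprVn exprMn aE.
  have := mE x; have := m0 x; have := u0 x.
  move: (Num.sqrt _) => m ux m_ge0 Em.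
  have -> : v x ^+ 2 = (m - u x) * (m + u x) by lra.
  by field; rewrite gt_eqF //; lra.
- by move=> x; field; rewrite gt_eqF.
Qed.

(** For a constant, the sign of the imaginary part can be chosen once and for all, so no half plane
    is needed. *)
Lemma has_sqrt_cst (c d : R) : has_sqrt (fun _ : T => c) (fun _ : T => d).
Proof.
pose m := Num.sqrt (c ^+ 2 + d ^+ 2).
have m0 : 0 <= m by exact: sqrtr_ge0.
have mE : m ^+ 2 = c ^+ 2 + d ^+ 2 by rewrite sqr_sqrtr // addr_ge0 ?sqr_ge0.
have /ler_normlP[cm1 cm2] : `|c| <= m.
  by rewrite -sqrtr_sqr ler_sqrt ?addr_ge0 ?sqr_ge0 // lerDl sqr_ge0.
exists (fun=> Num.sqrt ((m + c) / 2)).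
exists (fun=> (if 0 <= d then 1 else -1) * Num.sqrt ((m - c) / 2)).
split; [exact: cst_continuous|exact: cst_continuous| |].
- move=> _; rewrite exprMn !sqr_sqrtr; [|lra..].
  by case: ifP => _; rewrite ?sqrrN expr1n; field.
- move=> _; rewrite -mulrA [Num.sqrt _ * _]mulrCA -sqrtrM; last by lra.
  have -> : (m + c) / 2 * ((m - c) / 2) = (d / 2) ^+ 2.
    have dE : d ^+ 2 = m ^+ 2 - c ^+ 2 by rewrite mE; ring.
    by rewrite expr_div_n dE; field.
  rewrite sqrtr_sqr normf_div [`|2|]ger0_norm //.
  case: ifPn => [d0|]; first by rewrite ger0_norm //; field.
  by rewrite -ltNge => d0; rewrite ltr0_norm //; field.
Qed.

(** A positive dot product puts the quotient [(u' + i v') / (u + i v)] in the right half plane,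
    where it has the principal root; multiply this by the given root. *)
Lemma has_sqrt_dot_gt0 u v u' v' :
  continuous u -> continuous v -> continuous u' -> continuous v' ->
  (forall x, 0 < u x * u' x + v x * v' x) ->
  has_sqrt u v -> has_sqrt u' v'.
Proof.
move=> cu cv cu' cv' dot0 uv.
have n0 x : 0 < u x ^+ 2 + v x ^+ 2.
  rewrite lt_neqAle addr_ge0 ?sqr_ge0 // andbT eq_sym paddr_eq0 ?sqr_ge0 //.
  rewrite !sqrf_eq0; apply/negP => /andP[/eqP u0 /eqP v0].
  by have := dot0 x; rewrite u0 v0 !mul0r addr0 ltxx.
pose n x := u x ^+ 2 + v x ^+ 2.
have cn : continuous n by apply: continuous_add; apply: continuous_mul.
have n_neq0 x : n x != 0 by rewrite gt_eqF ?n0.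
have /(has_sqrt_mul uv) : has_sqrt (fun x => (u x * u' x + v x * v' x) / n x)
    (fun x => (u x * v' x - v x * u' x) / n x).
  apply: has_sqrt_gt0 => [||x]; last by rewrite divr_gt0 ?n0.
    by apply: continuous_div => //; apply: continuous_add; apply: continuous_mul.
  by apply: continuous_div => //; apply: continuous_sub; apply: continuous_mul.
by apply: has_sqrt_ext => x; have := n_neq0 x; rewrite /n => nx; field.
Qed.

End Sqrt.

(** By compactness of [T], slices at nearby times have a positive dot product at all points at once.
    Hence the set of times whose slice has a root is open and closed in the line, which is
    connected. *)
Lemma has_sqrt_homotopy (R : realType) (T : topologicalType) (u v : T * R -> R) :
  compact [set: T] -> continuous u -> continuous v ->
  (forall p, 0 < u p ^+ 2 + v p ^+ 2) ->
  has_sqrt (fun x => u (x, 0)) (fun x => v (x, 0)) ->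
  has_sqrt (fun x => u (x, 1)) (fun x => v (x, 1)).
Proof.
move=> cT cu cv uv0 sqrt0.
pose dot s t x := u (x, s) * u (x, t) + v (x, s) * v (x, t).
have cslice (w : T * R -> R) t : continuous w -> continuous (fun x => w (x, t)).
  move=> cw; apply: continuous_compose cw.
  by apply: continuous_pair => [x|]; [exact: cvg_id|exact: cst_continuous].
have near_dot s : \forall t \near s, forall x, 0 < dot s t x.
  have cd : continuous (fun p : T * R =>
      u (p.1, s) * u (p.1, p.2) + v (p.1, s) * v (p.1, p.2)).
    apply: continuous_add; apply: continuous_mul.
    - by apply: (continuous_compose _ (cslice u s cu)) => p; exact: cvg_fst.
    - by apply: continuous_compose cu; apply: continuous_pair => p;
        [exact: cvg_fst|exact: cvg_snd].
    - by apply: (continuous_compose _ (cslice v s cv)) => p; exact: cvg_fst.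
    - by apply: continuous_compose cv; apply: continuous_pair => p;
        [exact: cvg_fst|exact: cvg_snd].
  have : \forall t \near s, [set: T] `<=` (fun x => 0 < dot s t x).
    move/compact_near_coveringP : cT => cT.
    apply: (cT R (nbhs s) (fun t x => 0 < dot s t x)) => x _.
    apply: (cd (x, s) [set r | 0 < r]); apply: open_nbhs_nbhs.
    by split; [exact: open_gt|rewrite /= -!expr2].
  by apply: filterS => t H x; exact: H.
pose S := [set t : R | has_sqrt (fun x => u (x, t)) (fun x => v (x, t))].
have step s t : (forall x, 0 < dot s t x) -> S s -> S t.
  by move=> d0; apply: has_sqrt_dot_gt0 => //; exact: cslice.
have step' s t : (forall x, 0 < dot s t x) -> S t -> S s.
  move=> d0; apply: step => x; have := d0 x; rewrite /dot.
  by rewrite [u (x, s) * _]mulrC [v (x, s) * _]mulrC.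
have SE : S = setT.
  have /connected_intervalP : is_interval [set: R] by [].
  apply; first by exists 0.
  - exists S; last by rewrite setTI.
    rewrite openE => s Ss; apply: filterS (near_dot s) => t d0.
    exact: step d0 Ss.
  - exists S; last by rewrite setTI.
    rewrite -openC openE => s nSs; apply: filterS (near_dot s) => t d0.
    by move=> /(step' _ _ d0).
by have : [set: R] 1 by []; rewrite -SE.
Qed.

(** * Compactness and subspaces *)

(** Disjoint neighbourhoods of [f x] and [l] settle the matter near each [x]; compactness of [A]
    makes the bound on [n] uniform. *)
Lemma compact_near_avoid (U V : topologicalType) (A : set U) (f : U -> V)
    (y : nat -> V) (l : V) :
  hausdorff_space V -> compact A -> continuous f -> y n @[n --> \oo] --> l ->
  (forall x, A x -> f x <> l) ->
  \forall n \near \oo, forall x, A x -> f x <> y n.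
Proof.
rewrite open_hausdorff => hV /compact_near_coveringP cA cf yl fl.
apply: (cA nat \oo (fun n x => f x <> y n)) => x Ax.
have /eqP/hV[[B C] /= [/[!inE] Bx Cl] [oB oC BC0]] := fl x Ax.
exists (f @^-1` B, y @^-1` C).
  by split; [exact: (cf x _ (open_nbhs_nbhs _))|exact: (yl _ (open_nbhs_nbhs _))].
move=> [z n] /= [Bz Cn] fz; suff : set0 (f z) by [].
by rewrite -BC0; split => //; rewrite fz.
Qed.

Definition to_set_type (X : Type) (A : set X) (x : X) (Ax : A x) : set_type A :=
  exist (fun x => x \in A) x (mem_set Ax).

(** A near covering of the subtype becomes one of [A] by quantifying over the points of the subtype
    that lie over [x]. *)
Lemma compact_set_type (X : topologicalType) (A : set X) :
  compact A -> compact [set: set_type A].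
Proof.
move/compact_near_coveringP => cA; apply/compact_near_coveringP.
move=> D F P FF nP.
have : \forall i \near F, A `<=` (fun x => forall y : A, set_val y = x -> P i y).
  apply: (cA D F (fun i x => forall y : A, set_val y = x -> P i y)) => x Ax.
  have [[B J] /= [[_ [[W oW <-] Wx WB]] FJ] BJ] := nP (to_set_type Ax) I.
  exists (W, J); first by split => //; apply: open_nbhs_nbhs.
  move=> [z i] /= [Wz Ji] y yz; apply: (BJ (y, i)); split => //; apply: WB.
  by rewrite /= yz.
apply: filterS => i H x _; apply: (H (set_val x)) => //.
exact: set_valP.
Qed.

Lemma continuous_set_type (T X : topologicalType) (A : set X) (f : T -> A) :
  continuous (fun x => set_val (f x)) -> continuous f.
Proof. exact: continuous_comp_initial. Qed.

Lemma continuous_set_val (T X : topologicalType) (A : set X) (f : T -> A) :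
  continuous f -> continuous (fun x => set_val (f x)).
Proof. by move=> cf; apply: (continuous_compose cf); exact: initial_continuous. Qed.

(** * The outermost circle, centered at [(0, 1)] *)

Definition circle (R : realType) : set (R * R) :=
  [set p | p.1 ^+ 2 + (p.2 - 1) ^+ 2 = 1].
Arguments circle : clear implicits.

Lemma circleE (R : realType) (z : circle R) :
  (set_val z).1 ^+ 2 + ((set_val z).2 - 1) ^+ 2 = 1.
Proof. exact: set_valP z. Qed.

Lemma compact_circle (R : realType) : compact [set: circle R].
Proof.
apply: compact_set_type.
apply: (@subclosed_compact _ (circle R) (`[(-1 : R), 1] `*` `[(0 : R), 2])).
- have -> : circle R = (fun p => p.1 ^+ 2 + (p.2 - 1) ^+ 2) @^-1` [set 1] by [].
  apply: preimage_closed => [p _|]; last exact: closed_eq.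
  suff : continuous (fun p : R * R => p.1 * p.1 + (p.2 - 1) * (p.2 - 1)) by exact.
  have cx : continuous (fun p : R * R => p.1) by move=> ?; exact: cvg_fst.
  have cy : continuous (fun p : R * R => p.2 - 1).
    by apply: continuous_sub => [?|]; [exact: cvg_snd|exact: cst_continuous].
  by apply: continuous_add; exact: continuous_mul.
- by apply: compact_setX; exact: segment_compact.
- move=> [x y]; rewrite /circle /= !in_itv /= => E.
  have := sqr_ge0 x; have := sqr_ge0 (y - 1) => y0 x0.
  by split; apply/andP; split; nra.
Qed.

(* If [q] were a square root of [z], then [q (- z) / q z] would be a square
   root of [-1], with opposite values at [z] and [- z]; these are joined by
   a half circle. *)
Lemma circle_no_sqrt (R : realType) :
  ~ has_sqrt (fun z : circle R => (set_val z).1)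
             (fun z : circle R => (set_val z).2 - 1).
Proof.
move=> [a [b [ca cb ua vb]]].
have Kopp (z : circle R) : circle R (- (set_val z).1, 2 - (set_val z).2).
  by rewrite /circle /=; apply: etrans (circleE z); ring.
pose opp z : circle R := to_set_type (Kopp z).
have Kpath (t : R) : circle R (cos t, 1 + sin t).
  by rewrite /circle /= -(cos2Dsin2 t); ring.
pose path t : circle R := to_set_type (Kpath t).
have path_pi : path pi = opp (path 0).
  apply/val_inj; rewrite /= cospi sinpi cos0 sin0.
  by congr pair; ring.
have oppK z : opp (opp z) = z.
  by apply/val_inj => /=; rewrite opprK subKr -surjective_pairing.
have copp : continuous opp.
  apply: continuous_set_type.
  have cid : continuous (fun x : circle R => set_val x).
    exact: initial_continuous.
  apply: continuous_pair; first exact: continuous_opp (continuous_fst cid).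
  by apply: continuous_sub (continuous_snd cid); exact: cst_continuous.
have cpath : continuous path.
  apply: continuous_set_type; apply: continuous_pair; first exact: continuous_cos.
  by apply: continuous_add; [exact: cst_continuous|exact: continuous_sin].
(* The imaginary part of [q (- z)] times the conjugate of [q z], where [q = a + i b]. As [q z] has
   modulus 1, this is the imaginary part of [q (- z) / q z]. *)
pose d z := b (opp z) * a z - a (opp z) * b z.
have cd : continuous d.
  by apply: continuous_sub; apply: continuous_mul => //;
    exact: continuous_compose copp _.
have dN z : d (opp z) = - d z by rewrite /d oppK; ring.
have d_neq0 z : d z <> 0.
  move: (ua z) (vb z) (ua (opp z)) (vb (opp z)) (circleE z).
  rewrite /d /=; move: (set_val z).1 (set_val z).2 => x y.
  move: (a z) (b z) (a (opp z)) (b (opp z)) => A B A' B' h1 h2 h3 h4 E d0.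
  (* If [d] vanishes, the quotient is the real number [A' * A + B' * B], yet its square is [-1]. *)
  have : (A' * A + B' * B) ^+ 2 + 1 = 0 :> R.
    transitivity ((A' ^+ 2 - B' ^+ 2) * (A ^+ 2 - B ^+ 2)
        + (2 * A' * B') * (2 * A * B) + (B' * A - A' * B) ^+ 2 + 1); first ring.
    by rewrite -h1 -h2 -h3 -h4 d0; lra.
  by apply/eqP; rewrite gt_eqF // ltr_wpDl ?sqr_ge0.
have [||t _ /d_neq0//] := @IVT R (fun t => d (path t)) 0 pi 0 (pi_ge0 R).
- by apply: continuous_subspaceT; exact: continuous_compose cpath cd.
- rewrite path_pi dN; case: (leP 0 (d (path 0))) => h.
    by rewrite ge_min le_max h oppr_le0 h !orbT.
  by rewrite ge_min le_max oppr_ge0 (ltW h) !orbT.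
Qed.

(** * Homotopies whose time is restricted to the unit interval *)

Lemma continuous_within_comp (T U V : topologicalType) (A : set U) (h : U -> V)
    (phi : T -> U) : {within A, continuous h} -> continuous phi ->
  (forall x, A (phi x)) -> continuous (fun x => h (phi x)).
Proof.
move=> /subspace_sigL_continuousP ch cphi Aphi.
apply: (continuous_compose (f := fun x => to_set_type (Aphi x)) _ ch).
exact: continuous_set_type.
Qed.

Section Clamp.
Context {R : realType}.

(** Extends a homotopy over the unit interval to all real times, as [has_sqrt_homotopy] requires,
    without adding any new value. *)
Definition clamp (t : R) : R := Num.max 0 (Num.min 1 t).

Lemma clamp_itv t : 0 <= clamp t <= 1.
Proof. by rewrite /clamp le_max lexx ge_max ler01 ge_min lexx. Qed.

Lemma clamp0 : clamp 0 = 0.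
Proof. by rewrite /clamp min_r ?ler01 // maxxx. Qed.

Lemma clamp1 : clamp 1 = 1.
Proof. by rewrite /clamp minxx max_r ?ler01. Qed.

Lemma continuous_clamp : continuous clamp.
Proof.
apply: continuous_maxr; first exact: cst_continuous.
by apply: continuous_minr; [exact: cst_continuous|move=> ?; exact: cvg_id].
Qed.

End Clamp.

(** * The archipelago and its summits *)

Section Archipelago.
Context {R : realType}.
Notation HA := (set_type (harmonic_archipelago R)).

Definition summit (n : nat) : R * R * R := (peak R n, 1).

Lemma peak_bounds n : (0 < n)%N -> [/\ 0 < peak_radius R n,
  peak_radius R n < (peak R n).2 & (peak R n).2 + peak_radius R n < 2].
Proof.
move=> n0; rewrite /peak /peak_radius /=.
have x1 : 1 <= n%:R :> R by rewrite ler1n.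
have -> : n.+1%:R = n%:R + 1 :> R by rewrite -natr1.
have p1 : 1 / n%:R <= 1 :> R by rewrite div1r invf_le1 //; lra.
have p0 : 0 < 1 / n%:R :> R by rewrite divr_gt0 //; lra.
have q0 : 0 < 1 / (n%:R + 1) :> R by rewrite divr_gt0 //; lra.
have qp : 1 / (n%:R + 1) < 1 / n%:R :> R.
  by rewrite !div1r ltf_pV2 ?posrE; lra.
have q2 : 1 / (n%:R + 1) <= 1 / 2 :> R by rewrite !div1r lef_pV2 ?posrE; lra.
(* Written this way, the radius is linear in [1 / n] and [1 / (n + 1)], and so are the remaining
   inequalities. *)
have -> : 1 / (2 * n%:R * (n%:R + 1)) = (1 / n%:R - 1 / (n%:R + 1)) / 2 :> R.
  by field; apply/andP; split; lra.
by split; lra.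
Qed.

Lemma height_circle (p : R * R) : circle R p -> height p = 0.
Proof.
rewrite /circle /= => E; apply: height_out => n n0.
have [r0 ra ar] := peak_bounds n0.
rewrite /peak_disk /dist2 => d.
have : (p.1 - 0) ^+ 2 + (p.2 - (peak R n).2) ^+ 2 <= peak_radius R n ^+ 2.
  by rewrite -ler_sqrt ?sqr_ge0 // sqrtr_sqr (ger0_norm (ltW r0)).
move: E ra ar r0; case: p {d} => x y /=; rewrite subr0.
move: (peak_radius R n) (1 / n%:R + _) => r a E ra ar r0 h.
have x0 := sqr_ge0 x; have y0 := sqr_ge0 (y - 1).
have y1 : 0 <= y by nra.
have y2 : y <= 2 by nra.
(* On the circle, the squared distance to [(0, a)] is [a ^+ 2 + 2 * (1 - a) * y], affine in [y]. For
   [y] in [[0, 2]] it is at least [a ^+ 2] if [a <= 1] and at least [(2 - a) ^+ 2] otherwise; both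
   exceed [r ^+ 2]. *)
by case: (leP a 1) => a1; nra.
Qed.

Lemma circle_archipelago (z : circle R) :
  harmonic_archipelago R (set_val z, 0).
Proof.
exists (set_val z); last by rewrite (height_circle (set_valP z)).
by rewrite /base_disk /= circleE.
Qed.

Definition circle_incl (z : circle R) : HA := to_set_type (circle_archipelago z).

Lemma continuous_circle_incl : continuous circle_incl.
Proof.
apply: continuous_set_type; apply: continuous_pair; last exact: cst_continuous.
exact: initial_continuous.
Qed.

Lemma archipelago_summit n (w : HA) : (0 < n)%N ->
  (set_val w).1 = peak R n -> set_val w = summit n.
Proof.
move=> n0; have [p _ pw] := set_valP w; rewrite set_valE -pw /= => ->.
rewrite (height_peak_disk n0).
  by rewrite /dist2 !subrr expr0n addr0 sqrtr0 mul0r subr0.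
rewrite /peak_disk /= /dist2 !subrr expr0n addr0 sqrtr0.
by have [/ltW] := peak_bounds n0.
Qed.

(** The archipelago is a graph, so avoiding a summit means that the projection to the plane avoids
    the peak below it. *)
Lemma summit_neq n (w : HA) : (0 < n)%N -> set_val w <> summit n ->
  0 < (set_val w).1.1 ^+ 2 + ((set_val w).1.2 - (peak R n).2) ^+ 2.
Proof.
move=> n0 wn; rewrite lt_neqAle addr_ge0 ?sqr_ge0 // andbT eq_sym.
rewrite paddr_eq0 ?sqr_ge0 // !sqrf_eq0 subr_eq0.
apply/negP => /andP[/eqP u0 /eqP v0]; apply: wn.
by apply: archipelago_summit => //; rewrite [LHS]surjective_pairing u0 v0.
Qed.

Lemma summit_cvg : summit n @[n --> \oo] --> (((0, 0), 1) : R * R * R).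
Proof.
have h : 1 / n.+1%:R @[n --> \oo] --> (0 : R).
  by under eq_fun do rewrite div1r; exact: cvg_harmonic.
have h' : 1 / n%:R @[n --> \oo] --> (0 : R) by rewrite -(cvg_shiftS).
have h2 : 1 / n%:R + 1 / n.+1%:R @[n --> \oo] --> (0 : R).
  by rewrite -[X in _ --> X]addr0; apply: cvgD.
refine (@cvg_pair _ _ _ \oo (nbhs (0 : R, 0 : R)) (nbhs (1 : R)) _ _ _ _ _ _ _).
  refine (@cvg_pair _ _ _ \oo (nbhs (0 : R)) (nbhs (0 : R)) _ _ _ _ _ _ h2).
  exact: cvg_cst.
exact: cvg_cst.
Qed.

(** Points of the peak disks have positive second coordinate, so the height at the origin is 0 and
    not 1. *)
Lemma archipelago_not_limit (w : HA) : set_val w <> ((0, 0), 1).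
Proof.
have [p _ pw] := set_valP w; rewrite set_valE -pw => -[->]; rewrite height_out.
  by move/eqP; rewrite eq_sym oner_eq0.
move=> n n0 /(peak_disk_snd n0)/andP[] /=; rewrite ltNge => /negP h _; apply: h.
by rewrite divr_ge0.
Qed.

Lemma compact_near_summit (U : topologicalType) (A : set U) (psi : U -> HA) :
  compact A -> continuous psi ->
  \forall n \near \oo, forall x, A x -> set_val (psi x) <> summit n.
Proof.
move=> cA cpsi; apply: compact_near_avoid summit_cvg _ => //.
- exact: continuous_set_val.
- by move=> x _; exact: archipelago_not_limit.
Qed.

(** The complex function is the projection of [phi] minus the peak; the first coordinate of the peak
    is 0. *)
Definition has_sqrt_peak (T : topologicalType) (n : nat) (phi : T -> HA) :=
  has_sqrt (fun x => (set_val (phi x)).1.1)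
           (fun x => (set_val (phi x)).1.2 - (peak R n).2).

Lemma has_sqrt_peak_homotopy (T : topologicalType) (n : nat) (psi : T * R -> HA) :
  (0 < n)%N -> compact [set: T] -> continuous psi ->
  (forall p, ([set: T] `*` `[0, 1]) p -> set_val (psi p) <> summit n) ->
  has_sqrt_peak n (fun x => psi (x, 0)) -> has_sqrt_peak n (fun x => psi (x, 1)).
Proof.
move=> n0 cT cpsi avoid sqrt0.
pose psi' p := psi (p.1, clamp p.2).
have cpsi' : continuous (fun p => (set_val (psi' p)).1).
  apply: continuous_fst; apply: continuous_set_val.
  apply: continuous_compose cpsi; apply: continuous_pair => [p|].
    exact: cvg_fst.
  by apply: continuous_compose continuous_clamp => p; exact: cvg_snd.
have := @has_sqrt_homotopy R T (fun p => (set_val (psi' p)).1.1)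
  (fun p => (set_val (psi' p)).1.2 - (peak R n).2) cT.
rewrite /psi' /= clamp0 clamp1; apply => //.
- exact: continuous_fst.
- by apply: continuous_sub; [exact: continuous_snd|exact: cst_continuous].
- move=> p; apply: (summit_neq n0); apply: avoid.
  by split => //=; rewrite in_itv /=; exact: clamp_itv.
Qed.

End Archipelago.

(** * The two contractible cones of the Griffiths space *)

Section Griffiths.
Context {R : realType}.
Implicit Types p : R * R * R.
Notation G := (set_type (griffiths R)).
Notation HA := (set_type (harmonic_archipelago R)).

Definition apex : R * R * R := (0, 0, 1).
Definition upper_cone := cone (hawaiian_plus R) apex.

(** On a base circle of radius [q <= 1], [x ^+ 2 + y ^+ 2 = 2 * q * y] gives [0 <= y] and
    [x ^+ 2 <= 2 * y]; scaling by [t <= 1] preserves both. *)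
Lemma upper_coneP p : upper_cone p ->
  [/\ 0 <= p.1.2, 0 <= p.2 & p.1.1 ^+ 2 <= 2 * p.1.2].
Proof.
move=> [[[x y] z] [n n0 [/= E ->]] [t]]; rewrite /= in_itv /= => /andP[t0 t1] <-.
rewrite /= /GRing.scale /= !mulr0 !add0r mulr1 addr0.
have q0 : 0 < 1 / n%:R :> R by rewrite divr_gt0 ?ltr0n.
have q1 : 1 / n%:R <= 1 :> R by rewrite div1r invf_le1 ?ltr0n // ler1n.
move: (1 / n%:R) q0 q1 E => q q0 q1 E.
have E' : x ^+ 2 + y ^+ 2 = 2 * q * y by lra.
have y0 : 0 <= y.
  by rewrite -(pmulr_rge0 y (_ : 0 < 2 * q)) ?mulr_gt0 // -E' addr_ge0 ?sqr_ge0.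
split; [exact: mulr_ge0|by rewrite subr_ge0|].
have x2 : x ^+ 2 <= 2 * y by have := sqr_ge0 y; nra.
rewrite exprMn; apply: (le_trans (ler_wpM2l (sqr_ge0 t) x2)).
have -> : t ^+ 2 * (2 * y) = t * (2 * (t * y)) by ring.
by rewrite ler_piMl // !mulr_ge0.
Qed.

(** Central symmetry exchanges the cones, which reduces the lower one to the upper one. *)
Lemma lower_cone_opp p :
  cone (hawaiian_minus R) (0, 0, -1) p -> upper_cone (- p).
Proof.
move=> [m [n n0 [E m0]] [t t01 <-]]; exists (- m).
  by exists n => //=; rewrite m0 oppr0; split => //; rewrite -E; ring.
exists t => //; rewrite scalerN opprD; congr (_ - _).
rewrite -scalerN; congr (_ *: _); rewrite /apex.
by congr (_, _, _); rewrite /= ?oppr0 ?opprK.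
Qed.

Lemma upper_cone_opp p :
  upper_cone p -> cone (hawaiian_minus R) (0, 0, -1) (- p).
Proof.
move=> [m [n n0 [E m0]] [t t01 <-]]; exists (- m).
  by exists n => //=; rewrite m0 oppr0; split => //; rewrite -E; ring.
exists t => //; rewrite scalerN opprD; congr (_ - _).
rewrite -scalerN; congr (_ *: _); rewrite /apex.
by congr (_, _, _); rewrite /= ?oppr0 ?opprK.
Qed.

Lemma griffithsP p : griffiths R p <-> upper_cone p \/ upper_cone (- p).
Proof.
split=> [[]|[]]; [by left|by right; exact: lower_cone_opp|by left|].
by move/upper_cone_opp; rewrite opprK; right.
Qed.

Lemma griffiths_opp p : griffiths R p -> griffiths R (- p).
Proof. by rewrite !griffithsP opprK => -[]; [right|left]. Qed.

Lemma upper_cone0 : upper_cone 0.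
Proof.
exists 0.
  by exists 1%N => //=; split => //; rewrite !sub0r expr0n add0r sqrrN.
exists 1; first by rewrite /= in_itv /= ler01 lexx.
by rewrite subrr scale0r scaler0 addr0.
Qed.

Lemma upper_cone_star p t : upper_cone p -> 0 <= t <= 1 ->
  upper_cone ((1 - t) *: apex + t *: p).
Proof.
(* Parameters along the segment from the apex to [m] multiply. *)
move=> [m mH [s /= s01 <-]] t01; exists m => //; exists (t * s).
  move: s01 t01; rewrite !in_itv /= => /andP[s0 s1] /andP[t0 t1].
  by apply/andP; split; [exact: mulr_ge0|exact: mulr_ile1].
rewrite scalerDr !scalerA addrA -scalerDl; congr (_ *: _ + _).
by ring.
Qed.

(* Maps the lower cone to the common point of the two cones; on the upper one
   [x ^+ 2 <= 2 * y], so that nothing is cut off there. *)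
Definition retract p : R * R * R :=
  let s := Num.sqrt (2 * Num.max p.1.2 0) in
  (Num.max (- s) (Num.min s p.1.1), Num.max p.1.2 0, Num.max p.2 0).

Lemma retract_upper p : upper_cone p -> retract p = p.
Proof.
move=> /upper_coneP; case: p => -[x y] z /= [y0 z0 xy].
rewrite /retract /= (max_l y0) (max_l z0).
have /ler_normlP[h1 h2] : `|x| <= Num.sqrt (2 * y).
  by rewrite -sqrtr_sqr ler_sqrt // mulr_ge0.
by rewrite (min_r h2) max_r // lerNl.
Qed.

(** Here [y <= 0], so the interval [[- s, s]] to which [x] is clipped reduces to 0. *)
Lemma retract_lower p : upper_cone (- p) -> retract p = 0.
Proof.
move=> /upper_coneP; case: p => -[x y] z /= [].
rewrite !oppr_ge0 => y0 z0 xy; rewrite /retract /= (max_r y0) (max_r z0).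
rewrite mulr0 sqrtr0 oppr0 max_l //.
by rewrite ge_min lexx.
Qed.

Lemma continuous_retract : continuous retract.
Proof.
have cid : continuous (fun p : R * R * R => p) by move=> p; exact: cvg_id.
have cx := continuous_fst (continuous_fst cid).
have cy := continuous_snd (continuous_fst cid).
have cz := continuous_snd cid.
have c0 := @cst_continuous (R * R * R)%type R 0.
have cs : continuous (fun p : R * R * R => Num.sqrt (2 * Num.max p.1.2 0)).
  apply: continuous_sqrt; apply: continuous_mul; first exact: cst_continuous.
  exact: continuous_maxr.
apply: continuous_pair; last exact: continuous_maxr.
apply: continuous_pair; last exact: continuous_maxr.
apply: continuous_maxr; first exact: continuous_opp.
exact: continuous_minr.
Qed.

Lemma retract_upper_cone p : griffiths R p -> upper_cone (retract p).
Proof.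
rewrite griffithsP => -[up|lp]; first by rewrite retract_upper.
by rewrite retract_lower //; exact: upper_cone0.
Qed.

Lemma upper_griffiths p : upper_cone p -> griffiths R p.
Proof. by move=> up; apply/griffithsP; left. Qed.

Definition gopp (x : G) : G := to_set_type (griffiths_opp (set_valP x)).

Definition gretract (x : G) : G :=
  to_set_type (upper_griffiths (retract_upper_cone (set_valP x))).

(** Joins the constant map to the apex, at time 0, to the retraction onto the upper cone, at time
    1. *)
Definition gcontract (xt : G * R) : G :=
  to_set_type (upper_griffiths (upper_cone_star
    (retract_upper_cone (set_valP xt.1)) (clamp_itv xt.2))).

Lemma continuous_gopp : continuous gopp.
Proof.
apply: continuous_set_type => x; apply: continuousN.
exact: initial_continuous.
Qed.

Lemma continuous_gcontract : continuous gcontract.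
Proof.
apply: continuous_set_type.
have ct : continuous (fun xt : G * R => clamp xt.2).
  apply: continuous_compose continuous_clamp.
  by apply: continuous_snd => p; exact: cvg_id.
have cr : continuous (fun xt : G * R => retract (set_val xt.1)).
  apply: continuous_compose continuous_retract; apply: continuous_set_val.
  by apply: continuous_fst => p; exact: cvg_id.
move=> x /=; apply: cvgD; last by apply: cvgZ; [exact: ct|exact: cr].
apply: cvgZ; last exact: cvg_cst.
by apply: cvgB; [exact: cvg_cst|exact: ct].
Qed.

Lemma gcontract0 x y : gcontract (x, 0) = gcontract (y, 0).
Proof. by apply/val_inj; rewrite /= clamp0 !scale0r. Qed.

Lemma gcontract1 x : gcontract (x, 1) = gretract x.
Proof. by apply/val_inj; rewrite /= clamp1 subrr scale0r scale1r add0r. Qed.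

(** Conjugating [gretract] by [gopp] gives the retraction onto the lower cone; of the two
    retractions, one fixes [x] and the other collapses it. *)
Lemma gretract_cases (o x : G) : set_val o = 0 ->
  (gretract x = x /\ gopp (gretract (gopp x)) = o) \/
  (gretract x = o /\ gopp (gretract (gopp x)) = x).
Proof.
move=> o0; have /griffithsP[ux|lx] := set_valP x; [left|right].
  split; apply/val_inj; rewrite /= -?set_valE.
    exact: retract_upper.
  by rewrite o0 retract_lower ?opprK // oppr0.
split; apply/val_inj; rewrite /= -?set_valE.
  by rewrite retract_lower.
by rewrite retract_upper ?opprK.
Qed.

Lemma griffiths0 : griffiths R 0.
Proof. exact/upper_griffiths/upper_cone0. Qed.

Definition coned (T : topologicalType) (omega : T -> G) (f : G -> HA)
  (y : T * R) : HA := f (gcontract (omega y.1, y.2)).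

Lemma continuous_coned (T : topologicalType) (omega : T -> G) (f : G -> HA) :
  continuous omega -> continuous f -> continuous (coned omega f).
Proof.
move=> comega cf; apply: continuous_compose cf.
apply: continuous_compose continuous_gcontract; apply: continuous_pair => [|p].
  by apply: continuous_compose comega => p; exact: cvg_fst.
exact: cvg_snd.
Qed.

(** At time 0 the coned map is constant, hence has a root, which the homotopy carries to time 1. *)
Lemma has_sqrt_peak_coned (T : topologicalType) (n : nat) (omega : T -> G)
    (f : G -> HA) :
  (0 < n)%N -> compact [set: T] -> continuous omega -> continuous f ->
  (forall y, ([set: T] `*` `[0, 1]) y -> set_val (coned omega f y) <> summit n) ->
  has_sqrt_peak n (fun x => f (gretract (omega x))).
Proof.
move=> n0 cT comega cf avoid.
have cpsi := continuous_coned comega cf.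
under eq_fun do rewrite -gcontract1.
apply: (has_sqrt_peak_homotopy n0 cT cpsi avoid).
pose o : G := to_set_type griffiths0.
apply: has_sqrt_ext (has_sqrt_cst (set_val (f (gcontract (o, 0)))).1.1
  ((set_val (f (gcontract (o, 0)))).1.2 - (peak R n).2)) => x;
by rewrite /coned /= (gcontract0 o (omega x)).
Qed.

(* Over each point of [T], one of the two coned maps ends at [f (omega x)] and
   the other one at [f 0], so the product of their square roots is a square
   root of [f (omega x)] up to a constant. *)
Lemma has_sqrt_peak_griffiths (T : topologicalType) (n : nat) (omega : T -> G)
    (f : G -> HA) (omega' := fun x => gopp (omega x)) (f' := fun x => f (gopp x)) :
  (0 < n)%N -> compact [set: T] -> continuous omega -> continuous f ->
  (forall y, ([set: T] `*` `[0, 1]) y -> set_val (coned omega f y) <> summit n) ->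
  (forall y, ([set: T] `*` `[0, 1]) y -> set_val (coned omega' f' y) <> summit n) ->
  has_sqrt_peak n (fun x => f (omega x)).
Proof.
move=> n0 cT comega cf avoid avoid'.
have sqrt1 := has_sqrt_peak_coned n0 cT comega cf avoid.
have sqrt2 := has_sqrt_peak_coned n0 cT
  (continuous_compose comega continuous_gopp)
  (continuous_compose continuous_gopp cf) avoid'.
pose o : G := to_set_type griffiths0.
pose c1 := (set_val (f o)).1.1; pose c2 := (set_val (f o)).1.2 - (peak R n).2.
pose m := c1 ^+ 2 + c2 ^+ 2.
(* With [c = c1 + i c2], the last factor is a root of [1 / c], which cancels the contribution of the
   collapsed cone. *)
have := has_sqrt_mul (has_sqrt_mul sqrt1 sqrt2) (has_sqrt_cst (c1 / m) (- c2 / m)).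
(* That [f o] is off the summit is read off at time 1 from the coned map that collapses [x], so a
   point [x] of [T] is needed. *)
have m_neq0 x : gretract (omega x) = o \/ gopp (gretract (gopp (omega x))) = o ->
    m != 0.
  move=> xo; rewrite gt_eqF //; apply: summit_neq => // fo.
  have x1 : ([set: T] `*` (`[0, 1] : set R)) (x, 1).
    by split => //=; rewrite in_itv /= ler01 lexx.
  case: xo => xo; [apply: (avoid _ x1)|apply: (avoid' _ x1)].
    by rewrite /coned gcontract1 /= xo.
  by rewrite /coned /f' /omega' gcontract1 /= xo.
by apply: has_sqrt_ext => x; case: (gretract_cases (omega x) (erefl : set_val o = 0));
  rewrite /f' => -[e1 e2]; (have m0 : m != 0 by apply: (m_neq0 x); auto);
  rewrite e1 e2 -/c1 -/c2; move: m0; rewrite /m => m0; field.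
Qed.

End Griffiths.

(** * Comparison of the two spaces along the outermost circle *)

Theorem corollary1p4 (R : realType) :
  ~ homotopy_equivalent R (set_type (griffiths R))
      (set_type (harmonic_archipelago R)).
Proof.
move=> [f [g [cf cg _ [H [cH H0 H1]]]]].
pose omega z := g (circle_incl z).
have comega : continuous omega := continuous_compose (@continuous_circle_incl R) cg.
have ct : continuous (fun p : circle R * R => p.2) by move=> p; exact: cvg_snd.
have cx : continuous (fun p : circle R * R => p.1) by move=> p; exact: cvg_fst.
pose psi := coned omega f.
pose psi' := coned (fun x => gopp (omega x)) (fun x => f (gopp x)).
pose psi2 (p : circle R * R) := H (circle_incl p.1, clamp p.2).
have cpsi : continuous psi by exact: continuous_coned.
have cpsi' : continuous psi' 
  by apply: continuous_coned;
    [exact: continuous_compose comega continuous_gopp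
    |exact: continuous_compose continuous_gopp cf].
have cpsi2 : continuous psi2.
  apply: (continuous_within_comp cH) => [|p].
    apply: continuous_pair; last exact: continuous_compose ct continuous_clamp.
    exact: continuous_compose cx (@continuous_circle_incl R).
  by split => //=; rewrite in_itv /=; exact: clamp_itv.
have cA : compact ([set: circle R] `*` (`[0, 1] : set R)).
  by apply: compact_setX; [exact: compact_circle|exact: segment_compact].
have [n [n0 [avoid avoid' avoid2]]] : exists n, (0 < n)%N /\
    [/\ forall p, ([set: circle R] `*` `[0, 1]) p -> set_val (psi p) <> summit n,
        forall p, ([set: circle R] `*` `[0, 1]) p -> set_val (psi' p) <> summit n &
        forall p, ([set: circle R] `*` `[0, 1]) p -> set_val (psi2 p) <> summit n].
  (* Each of the three maps avoids almost all summits, so a single positive [n] serves them all. *)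
  apply: (@filter_ex _ \oo); near=> n; split; first by near: n; exact: nbhs_infty_gt.
  by split; near: n; exact: compact_near_summit.
have cC : compact [set: circle R] by exact: compact_circle.
have : has_sqrt_peak n (fun z => psi2 (z, 0)).
  have := has_sqrt_peak_griffiths n0 cC comega cf avoid avoid'.
  by apply: has_sqrt_ext => z; rewrite /psi2 /= clamp0 H0.
move/(has_sqrt_peak_homotopy n0 cC cpsi2 avoid2).
have cz : continuous (fun z : circle R => set_val z) by exact: initial_continuous.
have ca := @cst_continuous (circle R) R (peak R n).2.
have c1 := @cst_continuous (circle R) R 1.
have [r0 ra ar] := peak_bounds (R := R) n0.
move=> sqrt1; apply: (@circle_no_sqrt R); move: sqrt1.
have -> : (fun z => psi2 (z, 1)) = @circle_incl R.
  by apply/funext => z; rewrite /psi2 /= clamp1 H1.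
(* Moves the puncture from the peak to the center of the circle. *)
apply: has_sqrt_dot_gt0 => /=.
- exact: continuous_fst.
- by apply: continuous_sub => //; exact: continuous_snd.
- exact: continuous_fst.
- by apply: continuous_sub => //; exact: continuous_snd.
move=> z; have := circleE z; rewrite /= in ra ar.
move: (1 / n%:R + _) ra ar => a ra ar.
move: (set_val z).1 (set_val z).2 => x y E.
have x0 := sqr_ge0 x; have y0 := sqr_ge0 (y - 1).
have y1 : 0 <= y by nra.
have y2 : y <= 2 by nra.
(* The dot product is positive because [1 - a] has absolute value less than 1 and [y - 1] at most
   1. *)
have -> : x * x + (y - a) * (y - 1) = 1 + (1 - a) * (y - 1) by lra.
by case: (leP a 1) => a1; nra.
Unshelve. all: by end_near.
Qed.
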